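(* Let $S$ be a unanimity program of length $n$ with state set $Q$, and let $t \in \mathbb{N}_+$. Then $S$ is a sliding-window branching program (SWBP) of window size $t$ if and only if there are functions $\alpha_i\colon \{0,1\}^{k_i} \to Q$ for $i = 0,\dots,n$, where $k_i = i$ if $i < t$ and $k_i = t$ if $i \ge t$, such that: (1) for every $i < t$, every $w \in \{0,1\}^{i}$ and every $y \in \{0,1\}$: $S_i(\alpha_i(w), y) = \alpha_{i+1}(wy)$; (2) for every $t \le i < n$, every $x, y \in \{0,1\}$ and every $w \in \{0,1\}^{t-1}$: $S_i(\alpha_i(xw), y) = \alpha_{i+1}(wy)$. (Here $\alpha_0$ is defined on $\{0,1\}^0 = \{\lambda\}$, where $\lambda$ is the empty word.)
   Context: An (ordered, read-once) branching program of length $n$ and width $w$ consists of a state set $Q$ with $|Q| = w$, an initial state $q_0 \in Q$, and transition functions $P_1,\dots,P_n\colon Q\times\{0,1\}\to Q$; on input $x = x_1\cdots x_n \in \{0,1\}^n$ it starts in $q_0$ and in step $j$ moves from its current state $q$ to $P_j(q,x_j)$. For $0 \le i \le n$, $Q_i \subseteq Q$ denotes the set of states reachable after reading exactly $i$ bits (the $i$-th layer). For a state $q$ in layer $i$ and a string $y$ with $|y| \le n-i$, $S_i(q,y)$ denotes the state reached by starting in $q$ at layer $i$ and reading $y$ (i.e. applying $P_{i+1},\dots,P_{i+|y|}$ successively). A unanimity program is such a program together with subsets $Q^i_{\mathrm{acc}} \subseteq Q_i$ for $i=1,\dots,n$; it accepts $x$ iff for every nonempty prefix $y$ of $x$ the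 state reached after reading $y$ from $q_0$ lies in $Q^{|y|}_{\mathrm{acc}}$. A sliding-window branching program (SWBP) of window size $t$ is a unanimity program such that for every $i \le n-t$, every $y \in \{0,1\}^t$ and every $q, q' \in Q_i$, $S_i(q,y) = S_i(q',y)$. *)

(* Defs.v *)
From mathcomp Require Import all_boot.

Set Implicit Arguments.
Unset Strict Implicit.
Unset Printing Implicit Defensive.

(* The width of a program is #|Q|.  Steps are indexed from 0:
   [step j] is the transition function P_{j+1}. *)
Record branching_program (n : nat) (Q : finType) := BranchingProgram {
  init : Q;
  step : 'I_n -> Q -> bool -> Q
}.

(* Applies P_{i+1}, ..., P_{i+|y|} successively, starting in q; it is [None]
   if one of these transition functions does not exist. *)
Fixpoint run (n : nat) (Q : finType) (B : branching_program n Q)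
    (i : nat) (q : Q) (y : seq bool) : option Q :=
  if y is b :: y' then
    if insub i is Some j then run B i.+1 (step B j q b) y' else None
  else Some q.

Definition layer (n : nat) (Q : finType) (B : branching_program n Q)
    (i : nat) : {set Q} :=
  [set q | [exists x : i.-tuple bool, run B 0 (init B) x == Some q]].

(* S_i(q,y), which has a meaning only for q in the i-th layer and
   |y| <= n - i; it is [None] outside this domain. *)
Definition state_after (n : nat) (Q : finType) (B : branching_program n Q)
    (i : nat) (q : Q) (y : seq bool) : option Q :=
  if q \in layer B i then run B i q y else None.

(* [acc j] is the set of accepting states of layer j+1. *)
Record unanimity_program (n : nat) (Q : finType) := UnanimityProgram {
  program :> branching_program n Q;
  acc : 'I_n -> {set Q};
  acc_sub : forall j : 'I_n, acc j \subset layer program j.+1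
}.

Definition accepts (n : nat) (Q : finType) (S : unanimity_program n Q)
    (x : n.-tuple bool) : Prop :=
  forall j : 'I_n,
    exists2 q, state_after S 0 (init S) (take j.+1 x) = Some q & q \in acc S j.

Definition is_SWBP (n : nat) (Q : finType) (t : nat)
    (S : unanimity_program n Q) : Prop :=
  forall i : nat, i + t <= n ->
  forall (y : t.-tuple bool) (q q' : Q),
    q \in layer S i -> q' \in layer S i ->
    state_after S i q y = state_after S i q' y.

(* k_i *)
Definition window (t i : nat) : nat := if i < t then i else t.

(* Used to cast words to the domains {0,1}^{k_i}. *)
Lemma window_le (t i : nat) : i <= t -> i = window t i.
Proof. by rewrite /window; case: ltngtP. Qed.

Lemma window_ge (t i : nat) : 0 < t -> t <= i -> t.-1.+1 = window t i.
Proof. by move=> t0 ti; rewrite /window ltnNge ti prednK. Qed.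

(* Main.v *)
(* The windows alpha_i exist because the state reached on a word x of length
   i depends only on the last k_i bits of x: take alpha_i(w) to be the state
   reached on the input 0^(i - k_i) w.  Conversely (1) and (2) force alpha_i to
   map the last k_i bits of x to the state reached on x. *)
Require Import Defs.
From mathcomp Require Import all_boot.

Set Implicit Arguments.
Unset Strict Implicit.
Unset Printing Implicit Defensive.

Section Run.

Variables (n : nat) (Q : finType) (B : branching_program n Q).

Lemma run_cat (i : nat) (q : Q) (x y : seq bool) :
  run B i q (x ++ y) = obind (run B (i + size x) ^~ y) (run B i q x).
Proof.
elim: x i q => [|b x IHx] i q /=; first by rewrite addn0.
by case: insub => [j|] //=; rewrite IHx addSnnS.
Qed.

Lemma run_def (i : nat) (q : Q) (x : seq bool) :
  i + size x <= n -> exists q', run B i q x = Some q'.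
Proof.
elim: x i q => [|b x IHx] i q /=; first by exists q.
rewrite -addSnnS => le_n.
by rewrite (insubT (fun j => j < n) (leq_trans (leq_addr _ _) le_n)); apply: IHx.
Qed.

Lemma layerP (i : nat) (q : Q) :
  reflect (exists2 x, size x = i & run B 0 (init B) x = Some q)
          (q \in layer B i).
Proof.
rewrite inE; apply: (iffP existsP) => [[x /eqP def_q]|[x sz_x def_q]].
  by exists x; rewrite ?size_tuple.
by rewrite -sz_x; exists (in_tuple x); apply/eqP.
Qed.

(** The guard of [state_after] holds because [x] itself witnesses that [q] is reachable. This turns
    S_i into a run from the initial state. *)
Lemma state_after_run (x y : seq bool) (q : Q) :
  run B 0 (init B) x = Some q ->
  state_after B (size x) q y = run B 0 (init B) (x ++ y).
Proof.
move=> def_q; rewrite /state_after run_cat def_q /=.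
by case: layerP => // [[]]; exists x.
Qed.

Lemma state_after_some (i : nat) (q q' : Q) (y : seq bool) :
  state_after B i q y = Some q' -> q \in layer B i.
Proof. by rewrite /state_after; case: ifP. Qed.

Lemma layer0 (q : Q) : q \in layer B 0 -> q = init B.
Proof. by case/layerP=> x /size0nil -> [->]. Qed.

(** Total, to avoid options in the windows; the default [init B] occurs only for words longer than
    [n]. *)
Definition final (x : seq bool) : Q := odflt (init B) (run B 0 (init B) x).

Lemma run_final (x : seq bool) :
  size x <= n -> run B 0 (init B) x = Some (final x).
Proof. by rewrite /final => le_n; have [q ->] := @run_def 0 (init B) x le_n. Qed.

Lemma state_after_final (x : seq bool) (y : bool) :
  size x < n ->
  state_after B (size x) (final x) [:: y] = Some (final (rcons x y)).
Proof.
move=> lt_n; rewrite (state_after_run _ (run_final (ltnW lt_n))) cats1.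
by rewrite run_final // size_rcons.
Qed.

End Run.

(** Both prefixes lead into the same layer, where reading the [t] bits of [y] merges all states. *)
Lemma SWBP_final (n : nat) (Q : finType) (S : unanimity_program n Q) (t : nat)
    (x x' y : seq bool) :
  is_SWBP t S -> size y = t -> size x = size x' -> size x + t <= n ->
  final S (x ++ y) = final S (x' ++ y).
Proof.
move=> swS sz_y sz_x le_n; have le_x := leq_trans (leq_addr t _) le_n.
have rx := run_final S le_x.
have rx' : run S 0 (init S) x' = Some (final S x') by rewrite run_final -?sz_x.
have lx : final S x \in layer S (size x) by apply/layerP; exists x.
have lx' : final S x' \in layer S (size x) by apply/layerP; exists x'.
have := swS _ le_n (tcast sz_y (in_tuple y)) _ _ lx lx'; rewrite val_tcast /=.
by rewrite (state_after_run _ rx) sz_x (state_after_run _ rx') /final => ->.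
Qed.

(* [a i] stands for alpha_i extended by junk values to all words, which frees
   the induction of the casts. *)
Lemma run_window (n : nat) (Q : finType) (B : branching_program n Q) (t : nat)
    (a : nat -> seq bool -> Q) :
  0 < t ->
  (forall i w y, i < t -> i < n -> size w = i ->
     state_after B i (a i w) [:: y] = Some (a i.+1 (rcons w y))) ->
  (forall i x w y, t <= i -> i < n -> size w = t.-1 ->
     state_after B i (a i (x :: w)) [:: y] = Some (a i.+1 (rcons w y))) ->
  0 < n -> forall x, size x <= n ->
  run B 0 (init B) x = Some (a (size x) (drop (size x - t) x)).
Proof.
move=> t_gt0 a_short a_long n_gt0; elim/last_ind=> [_|x y IHx] /=.
  (* Reading any bit from [a 0 [::]] is defined, so this state lies in layer 0, which contains only
     [init B]. Such a step exists only if [0 < n]. *)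
  by have /state_after_some/layer0 <- := a_short 0 [::] true t_gt0 n_gt0 erefl.
rewrite size_rcons => lt_n; have rx := IHx (ltnW lt_n).
rewrite -cats1 -(state_after_run _ rx) cats1.
have [lt_t|le_t] := ltnP (size x) t.
  (* Neither [x] nor [rcons x y] is longer than [t], so both windows are the whole word. *)
  move: (ltnW lt_t); rewrite -subn_eq0 => /eqP->; move: (lt_t).
  by rewrite -subn_eq0 => /eqP->; rewrite !drop0 a_short.
(* The window of [x] is full: its first bit is split off and falls out when [y] enters. *)
have lt_sub : size x - t < size x by rewrite ltn_subrL t_gt0 (leq_trans t_gt0).
rewrite (drop_nth false lt_sub) a_long //; last first.
  by rewrite size_drop subnS subKn.
by rewrite subSn // drop_rcons.
Qed.

Theorem theorem1p4 (n : nat) (Q : finType) (S : unanimity_program n Q)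
    (t : nat) (ht : 0 < t) :
  is_SWBP t S <->
  exists alpha : forall i : nat, (window t i).-tuple bool -> Q,
    (forall (i : nat) (hit : i < t), i < n ->
       forall (w : i.-tuple bool) (y : bool),
         state_after S i (alpha i (tcast (window_le (ltnW hit)) w)) [:: y]
         = Some (alpha i.+1 (tcast (window_le hit) [tuple of rcons w y])))
    /\
    (forall (i : nat) (hti : t <= i), i < n ->
       forall (x y : bool) (w : t.-1.-tuple bool),
         state_after S i
           (alpha i (tcast (window_ge ht hti) [tuple of x :: w])) [:: y]
         = Some (alpha i.+1
             (tcast (window_ge ht (leqW hti)) [tuple of rcons w y]))).
Proof.
split=> [swS|[alpha [a_short a_long]]].
  exists (fun i w => final S (nseq (i - window t i) false ++ w)); split.
    move=> i lt_t lt_n w y; rewrite !val_tcast /= -!window_le ?(ltnW lt_t) //.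
    by rewrite !subnn /= -{1}(size_tuple w) state_after_final ?size_tuple.
  move=> i le_t lt_n x y w; rewrite !val_tcast /=.
  rewrite -!window_ge ?(leqW le_t) // prednK // subSn //.
  set z := nseq (i - t) false.
  have sz : size (z ++ x :: w) = i.
    by rewrite size_cat size_nseq /= size_tuple prednK // subnK.
  (* Regrouped as [rcons z x ++ rcons w y], the word differs from the padded one only before its
     last [t] bits. *)
  rewrite -{1}sz state_after_final ?sz // -cat_rcons rcons_cat.
  congr Some; apply: (SWBP_final swS).
  - by rewrite size_rcons size_tuple prednK.
  - by rewrite size_rcons /= size_nseq.
  - by rewrite size_rcons size_nseq addSn subnK.
(* The all-false word replaces words of the wrong length. As [a] sees only the underlying sequence,
   casts disappear under it. *)
pose a i w := alpha i (insubd (nseq_tuple (window t i) false) w).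
have aE i (w : (window t i).-tuple bool) : alpha i w = a i w by rewrite /a valKd.
move=> i le_n y q q' /layerP[x sz_x rx] /layerP[x' sz_x' rx']; subst i.
rewrite (state_after_run _ rx) -sz_x' (state_after_run _ rx').
(* For [n = 0] the hypotheses would not constrain [alpha 0], but then no window of length [t]
   fits. *)
have n_gt0 : 0 < n by apply: leq_trans le_n; rewrite addn_gt0 ht orbT.
have short j w b : j < t -> j < n -> size w = j ->
    state_after S j (a j w) [:: b] = Some (a j.+1 (rcons w b)).
  move=> lt_t lt_n sz_w.
  have := a_short j lt_t lt_n (Tuple (introT eqP sz_w)) b.
  by rewrite !aE !val_tcast.
have long j c w b : t <= j -> j < n -> size w = t.-1 ->
    state_after S j (a j (c :: w)) [:: b] = Some (a j.+1 (rcons w b)).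
  move=> le_t lt_n sz_w.
  have := a_long j le_t lt_n c b (Tuple (introT eqP sz_w)).
  by rewrite !aE !val_tcast.
(* The words [x ++ y] and [x' ++ y] have equal length and the same window [y]. *)
rewrite !(run_window ht short long n_gt0) ?size_cat ?size_tuple ?sz_x' //.
by rewrite !addnK !drop_size_cat.
Qed.
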